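(* Let $D$ be a finite or infinite digraph and let $A\subseteq X(D)$. (a) The following are equivalent: (i) $A$ is a point-reaching set of $D$; (ii) $A^*$ is a point-reaching set of the condensation $D^*$; (iii) $A$ contains at least one vertex from each initial strong component of $D$, and $A\cap R'(u)\neq\emptyset$ for every vertex $u$ of $D$ whose shadow $R'(u)$ contains no initial strong component of $D$; (iv) $A$ contains at least one vertex from each initial strong component of $D$, and $A\cap R'(u)$ is infinite for every vertex $u$ of $D$ whose shadow $R'(u)$ contains no initial strong component of $D$. (b) Every point-basis of $D$ (if one exists) consists of exactly one vertex from each initial strong component of $D$ and no other vertices.
   Context: $D$ is a digraph with vertex set $X(D)$ (arcs are ordered pairs of distinct vertices), possibly infinite. $v$ is reachable from $u$ if there is a directed path (possibly of length $0$) from $u$ to $v$. The shadow of $u$ is $R'(u)=\{z\in X(D): u \text{ is reachable from } z\}$. A strong component is a maximal subdigraph in which every vertex is reachable from every other; it is initial if no arc of $D$ enters it from outside. The condensation $D^*$ has one vertex for each strong component of $D$, with an arc $(C_1,C_2)$ iff $C_1\ne C_2$ and some arc $(u,v)$ of $D$ has $u\in C_1$, $v\in C_2$. For $S\subseteq X(D)$, $S^*$ is the set of strong components of $D$ meeting $S$ (a vertex set of $D^*$). A point-reaching set of a digraph is a vertex set $S$ such that every vertex is reachable from some vertex of $S$; a point-basis is an inclusion-minimal point-reaching set. *)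

(* Defs.v *)
From Stdlib Require List.
From mathcomp Require Import all_boot.
From mathcomp Require Import boolp classical_sets cardinality.

Set Implicit Arguments.
Unset Strict Implicit.
Unset Printing Implicit Defensive.

Local Open Scope classical_set_scope.

Record digraph := Digraph {
  vertex :> Type;
  arc : vertex -> vertex -> Prop;
  arc_irrefl : forall u, ~ arc u u }.

Fixpoint walk (T : Type) (e : T -> T -> Prop) (u : T) (p : seq T) : Prop :=
  if p is v :: q then e u v /\ walk e v q else True.

(* The path has vertex sequence [u :: p], hence length [size p]. *)
Definition dipath (T : Type) (e : T -> T -> Prop) (u : T) (p : seq T) : Prop :=
  walk e u p /\ List.NoDup (u :: p).

Definition joined (T : Type) (e : T -> T -> Prop) (u v : T) : Prop :=
  exists2 p, dipath e u p & last u p = v.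

Definition reachable (D : digraph) (u v : D) : Prop := joined (@arc D) u v.

Definition shadow (D : digraph) (u : D) : set D := [set z | reachable z u].

Record subdigraph (D : digraph) := Subdigraph {
  sub_vertex : set D;
  sub_arc : D -> D -> Prop;
  sub_arcP : forall u v,
    sub_arc u v -> [/\ arc u v, sub_vertex u & sub_vertex v] }.

Definition subdigraph_le (D : digraph) (H K : subdigraph D) : Prop :=
  sub_vertex H `<=` sub_vertex K /\
  (forall u v, sub_arc H u v -> sub_arc K u v).

(* Nonemptiness matters only for the digraph with no vertices, which has no
   strong component. *)
Definition strong (D : digraph) (H : subdigraph D) : Prop :=
  sub_vertex H !=set0 /\
  (forall u v, sub_vertex H u -> sub_vertex H v -> joined (sub_arc H) u v).

Definition strong_component (D : digraph) (H : subdigraph D) : Prop :=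
  strong H /\ (forall K, strong K -> subdigraph_le H K -> subdigraph_le K H).

Definition component (D : digraph) := {H : subdigraph D | strong_component H}.

Definition component_vertex (D : digraph) (C : component D) : set D :=
  sub_vertex (proj1_sig C).

Definition initial (D : digraph) (C : component D) : Prop :=
  ~ exists u v, [/\ arc u v, ~ component_vertex C u & component_vertex C v].

Definition condensation_arc (D : digraph) (C1 C2 : component D) : Prop :=
  C1 <> C2 /\
  exists u v, [/\ arc u v, component_vertex C1 u & component_vertex C2 v].

Lemma condensation_arc_irrefl (D : digraph) (C : component D) :
  ~ condensation_arc C C.
Proof. by case. Qed.

Definition condensation (D : digraph) : digraph :=
  Digraph (@condensation_arc_irrefl D).

Definition star (D : digraph) (S : set D) : set (condensation D) :=
  [set C : component D | S `&` component_vertex C !=set0].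

Definition point_reaching (D : digraph) (S : set D) : Prop :=
  forall v : D, exists2 u, S u & reachable u v.

Definition point_basis (D : digraph) (S : set D) : Prop :=
  point_reaching S /\
  (forall T : set D, T `<=` S -> point_reaching T -> T = S).

Definition meets_initial (D : digraph) (A : set D) : Prop :=
  forall C : component D, initial C -> A `&` component_vertex C !=set0.

Definition shadow_without_initial (D : digraph) (u : D) : Prop :=
  ~ exists C : component D, initial C /\ component_vertex C `<=` shadow u.

(* Main.v *)
(** Reachability in [D] and in its condensation correspond, which gives the
    equivalence of (i) and (ii).  Initial strong components are closed under
    predecessors, so a point-reaching set meets them.  If the shadow of [u]
    contains no initial strong component, then for every [a] in that shadow the
    component of [a] has an entering arc, and the shadow of the tail of that arc
    meets [A] in a vertex strictly above [a]: an infinite descent, which makes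
    the intersection of [A] with the shadow infinite.  In a point-basis, a vertex
    reachable from another one could be discarded; both claims of (b) follow. *)
Require Import Defs.
From Stdlib Require List.
From mathcomp Require Import all_boot.
From mathcomp Require Import boolp classical_sets cardinality.

Set Implicit Arguments.
Unset Strict Implicit.
Unset Printing Implicit Defensive.

Local Open Scope classical_set_scope.

(** * Directed paths and reachability *)

Lemma joined_refl (T : Type) (e : T -> T -> Prop) (u : T) : joined e u u.
Proof.
exists [::] => //; split=> //=.
by constructor; [case | constructor].
Qed.

Lemma dipath_suffix (T : Type) (e : T -> T -> Prop) (u x : T) (s p : seq T) :
  dipath e u (s ++ x :: p) -> dipath e x p.
Proof.
elim: s u => [|y s IH] u [/= w nd].
  by split; [case: w | move/List.NoDup_cons_iff: nd => []].
by apply: (IH y); split; [case: w | move/List.NoDup_cons_iff: nd => []].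
Qed.

(** Prepending [u] may repeat a vertex. In that case [u] already lies on the path from [v], and the
    part of that path starting at [u] serves instead. *)
Lemma joined_cons (T : Type) (e : T -> T -> Prop) (u v w : T) :
  e u v -> joined e v w -> joined e u w.
Proof.
move=> uv [p dp lp].
have [inu|ninu] := pselect (List.In u (v :: p)); last first.
  exists (v :: p) => //; case: dp => wp nd; split=> //.
  by constructor.
case: inu => [<-|/(@List.in_split _ _ _) [s [q pE]]]; first by exists p.
move: dp lp; rewrite pE => dp lp; exists q; first exact: dipath_suffix dp.
by move: lp; rewrite last_cat.
Qed.

Lemma joined_ind (T : Type) (e : T -> T -> Prop) (v : T) (P : T -> Prop) :
    P v -> (forall u w, e u w -> joined e w v -> P w -> P u) ->
  forall u, joined e u v -> P u.
Proof.
move=> P0 PS u [p [wp _] lp].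
suff [] : joined e u v /\ P u by [].
elim: p u wp lp => [|w p IH] u /= => [_ ->|[uw wp] lp].
  by split; first exact: joined_refl.
have [jw Pw] := IH _ wp lp.
by split; [exact: joined_cons uw jw | exact: PS uw jw Pw].
Qed.

Lemma joined_trans (T : Type) (e : T -> T -> Prop) (u v w : T) :
  joined e u v -> joined e v w -> joined e u w.
Proof.
move=> uv vw; move: u uv; apply: joined_ind => // x y xy _.
exact: joined_cons.
Qed.

Lemma joined_sub {T : Type} (e f : T -> T -> Prop) (u v : T) :
  (forall x y, e x y -> f x y) -> joined e u v -> joined f u v.
Proof.
move=> ef; move: u; apply: joined_ind; first exact: joined_refl.
by move=> x y /ef xy _; exact: joined_cons.
Qed.

(** * Strong components and the condensation *)

Section Digraph.
Variable D : digraph.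
Implicit Types (u v w x y a b : D) (A B : set D) (C : component D).

Lemma arc_reachable u v : Defs.arc u v -> reachable u v.
Proof. by move=> uv; apply: joined_cons uv _; exact: joined_refl. Qed.

Definition component_set u : set D :=
  [set z | reachable u z /\ reachable z u].

Lemma component_arcP u x y :
    [/\ Defs.arc x y, component_set u x & component_set u y] ->
  [/\ Defs.arc x y, component_set u x & component_set u y].
Proof. by []. Qed.

(** Every arc inside the class is kept, because maximality under [subdigraph_le] concerns arcs as
    well as vertices. *)
Definition component_subdigraph u : subdigraph D :=
  Subdigraph (@component_arcP u).

(** A path between two members of the class never leaves it: each of its vertices is reachable from
    [u] and reaches [y], hence [u]. *)
Lemma component_subdigraph_strong u : strong (component_subdigraph u).
Proof.
split; first by exists u; split; exact: joined_refl.
move=> x y ux uy.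
have [_ yu] := uy; have [_] := ux; have [+ _] := ux.
suff H : forall z, reachable z y -> reachable u z ->
    joined (sub_arc (component_subdigraph u)) z y.
  by move=> ux' xu; apply: H => //; case: uy => uy _; exact: joined_trans xu uy.
apply: joined_ind => [_|z w zw wy IH uz]; first exact: joined_refl.
have uw : reachable u w := joined_trans uz (arc_reachable zw).
have wu : reachable w u := joined_trans wy yu.
apply: joined_cons (IH uw); split=> //; split=> //.
exact: joined_cons zw wu.
Qed.

Lemma strong_reachable (H : subdigraph D) x y :
  strong H -> sub_vertex H x -> sub_vertex H y -> reachable x y.
Proof.
move=> [_ sH] Hx Hy; apply: joined_sub (sH _ _ Hx Hy).
by move=> a b /sub_arcP[].
Qed.

Lemma strong_le_component_subdigraph (H : subdigraph D) u :
  strong H -> sub_vertex H u -> subdigraph_le H (component_subdigraph u).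
Proof.
move=> sH Hu.
have HS x : sub_vertex H x -> component_set u x.
  by move=> Hx; split; exact: strong_reachable sH _ _.
by split=> // x y /sub_arcP[xy /HS ? /HS ?].
Qed.

Lemma component_subdigraphP u : strong_component (component_subdigraph u).
Proof.
split=> [|K sK [uK _]]; first exact: component_subdigraph_strong.
apply: strong_le_component_subdigraph => //.
by apply: uK; split; exact: joined_refl.
Qed.

Definition component_of u : component D := exist _ _ (component_subdigraphP u).

Lemma component_of_self u : component_vertex (component_of u) u.
Proof. by split; exact: joined_refl. Qed.

Lemma subdigraph_le_anti (H K : subdigraph D) :
  subdigraph_le H K -> subdigraph_le K H -> H = K.
Proof.
case: H K => [vH aH pH] [vK aK pK] [/= vHK aHK] [/= vKH aKH].
have vE : vH = vK by apply/seteqP; split.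
have aE : aH = aK.
  by apply/funext => x; apply/funext => y; apply/propext; split; auto.
subst vK aK; congr Subdigraph; exact: Prop_irrelevance.
Qed.

Lemma component_ofE C u : component_vertex C u -> C = component_of u.
Proof.
case: C => H sH Hu.
have le := strong_le_component_subdigraph sH.1 Hu.
apply: eq_exist; apply: subdigraph_le_anti => //.
exact: sH.2 (component_subdigraph_strong u) le.
Qed.

Lemma component_nonempty C : component_vertex C !=set0.
Proof. by case: C => H [[]]. Qed.

Lemma component_reachable C x y :
  component_vertex C x -> component_vertex C y -> reachable x y.
Proof. by case: C => H sH; exact: strong_reachable sH.1. Qed.

Lemma reachable_condensation (C1 C2 : component D) u v :
    component_vertex C1 u -> component_vertex C2 v -> reachable u v ->
  @reachable (condensation D) C1 C2.
Proof.
move=> C1u C2v uv; rewrite (component_ofE C1u) (component_ofE C2v).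
move: {C1u} u uv; apply: joined_ind.
  exact: joined_refl.
move=> x y xy _ IH.
(* An arc inside one component gives no arc of the condensation, so the path there is left
   unchanged. *)
have [<- //|neq] := pselect (component_of y = component_of x).
apply: (@joined_cons _ _ (component_of x) (component_of y)) IH.
split; first by move=> E; apply: neq.
by exists x, y; split=> //; exact: component_of_self.
Qed.

(** Arcs of the condensation lift one at a time; within a component, strong connectivity links the
    entry vertex to the tail of the next arc. *)
Lemma condensation_reachable (C1 C2 : component D) u v :
    @reachable (condensation D) C1 C2 ->
  component_vertex C1 u -> component_vertex C2 v -> reachable u v.
Proof.
move=> C12 + C2v; move: C1 C12 u.
apply: (@joined_ind (component D) (@condensation_arc D) C2).
  by move=> u C2u; exact: component_reachable C2u C2v.
move=> C C' [_ [x [y [xy Cx C'y]]]] _ IH u Cu.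
apply: joined_trans (component_reachable Cu Cx) _.
exact: joined_cons xy (IH _ C'y).
Qed.

(** * Initial components, point-reaching sets and shadows *)

Lemma initial_reachable C u v :
  initial C -> component_vertex C v -> reachable u v -> component_vertex C u.
Proof.
move=> iC Cv; move: u; apply: joined_ind => // x y xy _ Cy.
by apply: contrapT => nCx; apply: iC; exists x, y.
Qed.

Lemma noninitial_strict_predecessor u :
    ~ initial (component_of u) ->
  exists x, reachable x u /\ ~ reachable u x.
Proof.
move=> /contrapT[x [y [xy nux uy]]]; exists x.
have xu : reachable x u := joined_cons xy uy.2.
by split=> // ux; apply: nux.
Qed.

Lemma point_reaching_star A : point_reaching A <-> point_reaching (star A).
Proof.
split=> [pA C|pA v].
  have [v Cv] := component_nonempty C; have [u Au uv] := pA v.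
  exists (component_of u).
    by exists u; split=> //; exact: component_of_self.
  exact: reachable_condensation (component_of_self u) Cv uv.
have [C [a [Aa Ca]] Cv] := pA (component_of v); exists a => //.
exact: condensation_reachable Cv Ca (component_of_self v).
Qed.

Lemma point_reaching_meets_initial A : point_reaching A -> meets_initial A.
Proof.
move=> pA C iC; have [v Cv] := component_nonempty C; have [a Aa av] := pA v.
by exists a; split=> //; exact: initial_reachable av.
Qed.

Lemma shadow_without_initial_reachable u v :
  reachable v u -> shadow_without_initial u -> shadow_without_initial v.
Proof.
move=> vu su [C [iC Cv]]; apply: su; exists C; split=> // x /Cv xv.
exact: joined_trans xv vu.
Qed.

Lemma shadow_without_initial_component u :
  shadow_without_initial u -> ~ initial (component_of u).
Proof.
by move=> su iu; apply: su; exists (component_of u); split=> // x [].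
Qed.

End Digraph.

(** Induction on the length of a list [t] containing all elements of [X] below [x]. Passing to some
    [y] below [x] allows [y] to be removed from the list, since [y] is not below itself. *)
Lemma infinite_descent (T : Type) (r : T -> T -> Prop) (X : set T) :
    (forall x, ~ r x x) -> (forall x y z, r x y -> r y z -> r x z) ->
    X !=set0 -> (forall x, X x -> exists2 y, X y & r y x) ->
  infinite_set X.
Proof.
move=> irr tr [x0 Xx0] desc /(@finite_seqP {classic T})[s sE].
suff H : forall n (t : seq {classic T}) x, size t = n -> X x ->
    (forall y, X y -> r y x -> y \in t) -> False.
  by apply: (H _ s x0) => // y; rewrite sE.
elim=> [|n IH] t x st Xx xt; have [y Xy yx] := desc _ Xx; have yt := xt _ Xy yx.
  by move: yt; rewrite (size0nil st).
apply: (IH (rem (y : {classic T}) t) y) => //; first by rewrite size_rem // st.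
move=> z Xz zy; have zt := xt _ Xz (tr _ _ _ zy yx).
move: zt; rewrite (perm_mem (perm_to_rem yt)) inE => /orP[/eqP zE|//].
by case: (irr y); rewrite -{1}zE.
Qed.

Lemma infinite_shadow (D : digraph) (A : set D) (u : D) :
    (forall v : D, shadow_without_initial v -> A `&` shadow v !=set0) ->
    shadow_without_initial u ->
  infinite_set (A `&` shadow u).
Proof.
move=> hA su.
(* Strict reachability, since reachability itself is reflexive. *)
apply: (@infinite_descent _ (fun x y : D => reachable x y /\ ~ reachable y x)).
- by move=> x [].
- move=> x y z [xy nyx] [yz _]; split; first exact: joined_trans yz.
  by move=> zx; apply: nyx; exact: joined_trans yz zx.
- exact: hA.
move=> a [Aa au]; have sa := shadow_without_initial_reachable au su.
have [x [xa nax]] :=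
  noninitial_strict_predecessor (shadow_without_initial_component sa).
have [b [Ab bx]] := hA _ (shadow_without_initial_reachable xa sa).
have ba : reachable b a := joined_trans bx xa.
exists b; first by split=> //; exact: joined_trans ba au.
by split=> // ab; apply: nax; exact: joined_trans ab bx.
Qed.

(** If [x] and [y] differed, [x] would reach everything that [y] does, so [y] could be dropped
    against minimality. *)
Lemma point_basis_antichain (D : digraph) (B : set D) (x y : D) :
  point_basis B -> B x -> B y -> reachable x y -> x = y.
Proof.
move=> [pB minB] Bx By xy; apply: contrapT => nxy.
suff BE : B `\ y = B by move: By; rewrite -BE => -[_]; exact.
apply: minB => [z []//|v]; have [b Bb bv] := pB v.
have [bE|nby] := pselect (b = y); last by exists b.
by exists x => //; apply: joined_trans xy _; rewrite -bE.
Qed.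

Theorem theorem14 (D : digraph) (A : set D) :
  [<-> point_reaching A;
       point_reaching (star A);
       meets_initial A /\
         (forall u : D, shadow_without_initial u -> A `&` shadow u !=set0);
       meets_initial A /\
         (forall u : D, shadow_without_initial u ->
            infinite_set (A `&` shadow u))]
  /\
  (forall B : set D, point_basis B ->
     (forall C : component D, initial C ->
        exists! x : D, B x /\ component_vertex C x) /\
     (forall x : D, B x ->
        exists C : component D, initial C /\ component_vertex C x)).
Proof.
split.
  tfae.
  - by case: (point_reaching_star A).
  - case: (point_reaching_star A) => _ /[apply] pA.
    split; first exact: point_reaching_meets_initial.
    by move=> u _; have [a Aa au] := pA u; exists a.
  - by move=> [mA hA]; split=> // u; exact: infinite_shadow.
  (* Either the infinite set supplies a vertex reaching [v], or an initial component lies in the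
     shadow of [v] and its vertex in [A] does. *)
  - move=> [mA hA] v; have [/hA iA|/contrapT[C [iC Cv]]] :=
      pselect (shadow_without_initial v).
      have [a [Aa av]] : A `&` shadow v !=set0.
        by apply/set0P/eqP => A0; apply: iA; rewrite A0; exact: finite_set0.
      by exists a.
    by have [a [Aa Ca]] := mA _ iC; exists a => //; exact: Cv.
move=> B bB; split=> [C iC|x Bx].
  have [x [Bx Cx]] := point_reaching_meets_initial bB.1 iC.
  exists x; split=> // y [By Cy].
  exact: point_basis_antichain bB Bx By (component_reachable Cx Cy).
exists (component_of x); split; last exact: component_of_self.
(* Some [b] in [B] reaches the strict predecessor [y], hence [x]. Then [b = x], so [x] reaches [y],
   a contradiction. *)
apply: contrapT => /noninitial_strict_predecessor[y [yx nxy]].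
have [b Bb by_] := bB.1 y.
apply: nxy; rewrite -(point_basis_antichain bB Bb Bx) //.
exact: joined_trans by_ yx.
Qed.
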